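(* For each integer $n\geq 0$ and every $x\in\mathbb{C}$, \[ \sum_{k=0}^{\lfloor n/2\rfloor} \binom{n}{2k} C_{2(n-2k)}(x)\,\bigl(36x^2(9x^2-1)\bigr)^{k} E_{2k} = (18x^2-1)^{n}. \]
   Context: Lucas-balancing polynomials $C_n(x)$ are defined by $C_0(x)=1$, $C_1(x)=3x$, $C_n(x)=6xC_{n-1}(x)-C_{n-2}(x)$ for $n\geq 2$. Euler numbers $E_n$ are defined by $\sum_{n\geq 0}E_n\frac{z^n}{n!}=\frac{1}{\cosh z}$. *)

(* Defs.v *)
From Stdlib Require Import Reals Lra Lia Arith.
From Stdlib Require Import ClassicalEpsilon FunctionalExtensionality.
From Coquelicot Require Import Coquelicot.

Fixpoint lucas_balancing (n : nat) (x : C) : C :=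
  match n with
  | O => RtoC 1
  | S m =>
      match m with
      | O => (RtoC 3 * x)%C
      | S p => (RtoC 6 * x * lucas_balancing m x - lucas_balancing p x)%C
      end
  end.

Open Scope R_scope.

(* Both sides are read as functions of a real variable near 0; the series
   diverges for |z| > PI/2, so the identity cannot be asked for every z. *)
Definition euler_egf (E : nat -> R) : Prop :=
  locally 0 (fun z : R =>
    is_pseries (fun n => E n / INR (fact n)) z (1 / cosh z)).

Lemma CV_radius_ge_bound (a : nat -> R) (r M : R) :
  (forall n, Rabs (a n * r ^ n) <= M) -> Rbar_le r (CV_radius a).
Proof.
  intros H. destruct (CV_radius_bounded a) as [ub _].
  apply ub. now exists M.
Qed.

Lemma CV_radius_pos_of_near0 (a : nat -> R) (f : R -> R) :
  locally 0 (fun z : R => is_pseries a z (f z)) -> Rbar_lt 0 (CV_radius a).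
Proof.
  intros [d Hd].
  assert (d0 := cond_pos d).
  assert (Hz : is_pseries a (d / 2) (f (d / 2))).
  { apply Hd. change (Rabs (d / 2 - 0) < d).
    rewrite Rminus_0_r, Rabs_pos_eq; lra. }
  apply Rbar_lt_le_trans with (Rabs (d / 2)).
  - simpl. rewrite Rabs_pos_eq; lra.
  - apply Rbar_not_lt_le. intros Hlt.
    apply (CV_disk_outside a (d / 2) Hlt).
    apply ex_series_lim_0.
    apply ex_series_ext with (fun k => scal (pow_n (d / 2) k) (a k)).
    + intros n. rewrite pow_n_pow. apply Rmult_comm.
    + eexists. exact Hz.
Qed.

Definition cosh_coef (n : nat) : R := (1 + (-1) ^ n) / 2 / INR (fact n).

Lemma cosh_coef_0 : cosh_coef 0 = 1.
Proof. unfold cosh_coef. simpl. field. Qed.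

Lemma cosh_coef_bound (n : nat) : Rabs (cosh_coef n) <= 1.
Proof.
  unfold cosh_coef.
  assert (Hf : 1 <= INR (fact n)).
  { change 1 with (INR 1). apply le_INR. apply lt_O_fact. }
  assert (Hi : 0 < / INR (fact n) <= 1).
  { split. apply Rinv_0_lt_compat; lra.
    rewrite <- Rinv_1. apply Rinv_le_contravar; lra. }
  assert (Hs : (-1) ^ n = 1 \/ (-1) ^ n = -1).
  { induction n as [|n IH]; simpl. now left.
    destruct IH as [-> | ->]; try lra.
    - change 1 with (INR 1). apply le_INR. apply lt_O_fact.
    - split. apply Rinv_0_lt_compat, INR_fact_lt_0.
      rewrite <- Rinv_1. apply Rinv_le_contravar; [lra|].
      change 1 with (INR 1). apply le_INR. apply lt_O_fact. }
  unfold Rdiv at 1. apply Rabs_le.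
  destruct Hs as [-> | ->]; nra.
Qed.

Lemma is_pseries_cosh (z : R) : is_pseries cosh_coef z (cosh z).
Proof.
  assert (H1 : is_pseries (fun n => (-1) ^ n * / INR (fact n)) z (exp (- z))).
  { eapply is_series_ext; [| exact (is_exp_Reals (- z))].
    intros k. cbv beta. rewrite !pow_n_pow.
    change ((- z) ^ k * / INR (fact k)
            = z ^ k * ((-1) ^ k * / INR (fact k))).
    replace (- z) with (-1 * z) by ring. rewrite Rpow_mult_distr. ring. }
  assert (H := is_pseries_scal (/ 2) _ z _ (Rmult_comm _ _)
    (is_pseries_plus _ _ z _ _ (is_exp_Reals z) H1)).
  replace (cosh z) with (scal (/ 2) (plus (exp z) (exp (- z)))).
  - eapply is_pseries_ext; [| exact H].
    intros k. unfold PS_scal, PS_plus, cosh_coef, scal, plus; simpl;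
      unfold mult; simpl. field. apply INR_fact_neq_0.
  - unfold cosh, scal, plus; simpl; unfold mult; simpl. field.
Qed.

Lemma CV_radius_cosh (z : R) : Rbar_lt (Rabs z) (CV_radius cosh_coef).
Proof.
  apply Rbar_lt_le_trans with (Rabs (Rabs z + 1)).
  - simpl. assert (H := Rabs_pos z). rewrite (Rabs_pos_eq (_ + _)); lra.
  - apply Rbar_not_lt_le. intros Hlt.
    apply (CV_disk_outside _ _ Hlt).
    apply ex_series_lim_0.
    apply ex_series_ext with
      (fun k => scal (pow_n (Rabs z + 1) k) (cosh_coef k)).
    + intros n. rewrite pow_n_pow. apply Rmult_comm.
    + eexists. apply is_pseries_cosh.
Qed.

(* The coefficients of the reciprocal power series of cosh; [sech_tab n] is
   correct at all indices at most n. *)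
Fixpoint sech_tab (n : nat) : nat -> R :=
  match n with
  | O => fun _ => 1
  | S p => fun m =>
      if m <=? p then sech_tab p m
      else - sum_f_R0 (fun k => sech_tab p k * cosh_coef (S p - k)) p
  end.

Definition sech_coef (n : nat) : R := sech_tab n n.

Lemma sech_tab_le (n m : nat) : (m <= n)%nat -> sech_tab n m = sech_coef m.
Proof.
  induction n as [|n IH]; intros H.
  - now replace m with 0%nat by lia.
  - destruct (Nat.eq_dec m (S n)) as [-> | Hne]; [reflexivity|].
    simpl. rewrite (proj2 (Nat.leb_le m n)) by lia. apply IH. lia.
Qed.

Lemma sech_coef_S (n : nat) :
  sech_coef (S n)
  = - sum_f_R0 (fun k => sech_coef k * cosh_coef (S n - k)) n.
Proof.
  unfold sech_coef at 1. cbn -[Nat.leb cosh_coef Nat.sub sum_f_R0].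
  rewrite (proj2 (Nat.leb_gt (S n) n)) by lia.
  f_equal. apply sum_eq. intros i Hi. now rewrite sech_tab_le.
Qed.

Lemma sech_coef_bound (n : nat) : Rabs (sech_coef n) <= 2 ^ n.
Proof.
  induction n as [n IH] using lt_wf_ind.
  destruct n as [|n].
  - unfold sech_coef; simpl. rewrite Rabs_R1. lra.
  - rewrite sech_coef_S, Rabs_Ropp.
    eapply Rle_trans; [apply Rsum_abs|].
    apply Rle_trans with (sum_f_R0 (fun k => 2 ^ k) n).
    + apply sum_Rle. intros k Hk. rewrite Rabs_mult.
      assert (H1 := IH k ltac:(lia)).
      assert (H2 := cosh_coef_bound (S n - k)).
      assert (H3 := Rabs_pos (sech_coef k)).
      assert (H4 := Rabs_pos (cosh_coef (S n - k))). nra.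
    + rewrite tech3 by lra.
      assert (0 < 2 ^ S n) by (apply pow_lt; lra).
      replace ((1 - 2 ^ S n) / (1 - 2)) with (2 ^ S n - 1) by field. lra.
Qed.

Lemma PS_mult_sech_cosh (n : nat) :
  PS_mult sech_coef cosh_coef n = if n =? 0 then 1 else 0.
Proof.
  unfold PS_mult. destruct n as [|n].
  - simpl. rewrite cosh_coef_0. unfold sech_coef. simpl. ring.
  - rewrite tech5, Nat.sub_diag, cosh_coef_0, sech_coef_S.
    cbn [Nat.eqb]. ring.
Qed.

Lemma euler_egf_exists : exists E : nat -> R, euler_egf E.
Proof.
  exists (fun n => sech_coef n * INR (fact n)).
  exists (mkposreal (/ 2) ltac:(lra)). intros z Hz.
  change (Rabs (z - 0) < / 2) in Hz. rewrite Rminus_0_r in Hz.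
  assert (Ha : Rbar_lt (Rabs z) (CV_radius sech_coef)).
  { apply Rbar_lt_le_trans with (/ 2); [exact Hz|].
    apply CV_radius_ge_bound with 1. intros n.
    rewrite Rabs_mult, <- RPow_abs, (Rabs_pos_eq (/ 2)) by lra.
    assert (H := sech_coef_bound n).
    assert (Hp : 0 < (/ 2) ^ n) by (apply pow_lt; lra).
    replace 1 with (2 ^ n * (/ 2) ^ n).
    - apply Rmult_le_compat_r; lra.
    - rewrite <- Rpow_mult_distr, Rinv_r, pow1; lra. }
  assert (Hc : 0 < cosh z).
  { unfold cosh. assert (H1 := exp_pos z). assert (H2 := exp_pos (- z)). lra. }
  assert (Hs := PSeries_correct _ _ (CV_radius_inside _ _ Ha)).
  assert (Hm := is_pseries_mult _ _ _ _ _ Hs (is_pseries_cosh z) Ha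
                  (CV_radius_cosh z)).
  assert (H1 : PSeries (PS_mult sech_coef cosh_coef) z = 1).
  { rewrite (PSeries_ext _ _ z PS_mult_sech_cosh).
    rewrite PSeries_decr_1.
    - rewrite (PSeries_ext _ (fun _ => 0)) by reflexivity.
      rewrite PSeries_const_0. simpl. ring.
    - eapply ex_pseries_ext; [exact PS_mult_sech_cosh|]. eexists; exact Hm. }
  rewrite (is_pseries_unique _ _ _ Hm) in H1.
  replace (1 / cosh z) with (PSeries sech_coef z).
  - eapply is_pseries_ext; [|exact Hs].
    intros n. simpl. field. apply INR_fact_neq_0.
  - rewrite <- H1. field. lra.
Qed.

Lemma euler_egf_inj (E F : nat -> R) : euler_egf E -> euler_egf F -> E = F.
Proof.
  intros HE HF. apply functional_extensionality. intros n.
  assert (H : E n / INR (fact n) = F n / INR (fact n)).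
  { apply (PSeries_ext_recip (fun n => E n / INR (fact n))
             (fun n => F n / INR (fact n))).
    - exact (CV_radius_pos_of_near0 _ _ HE).
    - exact (CV_radius_pos_of_near0 _ _ HF).
    - generalize (filter_and _ _ HE HF). apply filter_imp.
      intros z [H1 H2].
      now rewrite (is_pseries_unique _ _ _ H1), (is_pseries_unique _ _ _ H2). }
  apply Rmult_eq_reg_r with (/ INR (fact n)); [exact H|].
  apply Rinv_neq_0_compat, INR_fact_neq_0.
Qed.

Lemma euler_egf_unique : exists! E : nat -> R, euler_egf E.
Proof.
  destruct euler_egf_exists as [E HE]. exists E. split; [exact HE|].
  intros F HF. now apply euler_egf_inj.
Qed.

Definition euler_number : nat -> R :=
  proj1_sig (constructive_definite_description euler_egf euler_egf_unique).

Lemma euler_numberP : euler_egf euler_number.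
Proof.
  exact (proj2_sig
    (constructive_definite_description euler_egf euler_egf_unique)).
Qed.

(* Main.v *)
Require Import Defs.
From Stdlib Require Import Reals.
From Coquelicot Require Import Coquelicot.
From Stdlib Require Import Lra Lia Arith.

(** Put [a = 18 x^2 - 1] and [D = a^2 - 1 = 36 x^2 (9 x^2 - 1)]. Since
    [C_{2m}(x) = T_m(a)] for the Chebyshev polynomials [T_m], the exponential
    generating function of [C_{2m}(x)] is [exp(a z) cosh(sqrt(D) z)], while that
    of the [E_{2k} D^k] (placed at the even indices) is [1 / cosh(sqrt(D) z)].
    The left-hand side is the binomial convolution of the two sequences, so it
    has generating function [exp(a z)]. *)

(* [ring] does not see through the Coquelicot structures on [C]. *)
Ltac Cring := match goal with |- ?a = ?b => change (@eq C a b); ring end.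

(** * Binomial convolution as a commutative algebra of sequences *)

(* The Leibniz rule [(F G)' = F' G + F G'] for exponential generating
   functions, on which the shift of sequences is the derivative. *)
Fixpoint binomial_conv (n : nat) (u v : nat -> C) : C :=
  match n with
  | O => (u O * v O)%C
  | S m => (binomial_conv m (fun k => u (S k)) v
            + binomial_conv m u (fun k => v (S k)))%C
  end.

Lemma binomial_conv_ext (n : nat) (u u' v v' : nat -> C) :
  (forall k, u k = u' k) -> (forall k, v k = v' k) ->
  binomial_conv n u v = binomial_conv n u' v'.
Proof.
  revert u u' v v'. induction n as [|n IH]; intros u u' v v' Hu Hv; simpl.
  - now rewrite Hu, Hv.
  - f_equal; apply IH; auto.
Qed.

Lemma binomial_conv_comm (n : nat) (u v : nat -> C) :
  binomial_conv n u v = binomial_conv n v u.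
Proof.
  revert u v. induction n as [|n IH]; intros u v; simpl; [ring|].
  rewrite (IH (fun k => u (S k))), (IH u). ring.
Qed.

Lemma binomial_conv_plus_l (n : nat) (u u' v : nat -> C) :
  binomial_conv n (fun k => (u k + u' k)%C) v
  = (binomial_conv n u v + binomial_conv n u' v)%C.
Proof.
  revert u u' v. induction n as [|n IH]; intros u u' v; simpl; [ring|].
  rewrite (IH (fun k => u (S k)) (fun k => u' (S k))), IH. ring.
Qed.

Lemma binomial_conv_plus_r (n : nat) (u v v' : nat -> C) :
  binomial_conv n u (fun k => (v k + v' k)%C)
  = (binomial_conv n u v + binomial_conv n u v')%C.
Proof.
  rewrite binomial_conv_comm, binomial_conv_plus_l.
  now rewrite (binomial_conv_comm n v), (binomial_conv_comm n v').
Qed.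

Lemma binomial_conv_scal_l (n : nat) (c : C) (u v : nat -> C) :
  binomial_conv n (fun k => (c * u k)%C) v = (c * binomial_conv n u v)%C.
Proof.
  revert u v. induction n as [|n IH]; intros u v; simpl; [ring|].
  rewrite (IH (fun k => u (S k))), IH. ring.
Qed.

Lemma binomial_conv_scal_r (n : nat) (c : C) (u v : nat -> C) :
  binomial_conv n u (fun k => (c * v k)%C) = (c * binomial_conv n u v)%C.
Proof.
  rewrite binomial_conv_comm, binomial_conv_scal_l.
  now rewrite binomial_conv_comm.
Qed.

(** By the Leibniz rule, each side at [S n] becomes the three terms in which one of [u], [v], [w] is
    shifted, so no double sum has to be reordered. *)
Lemma binomial_conv_assoc (n : nat) (u v w : nat -> C) :
  binomial_conv n (fun k => binomial_conv k u v) w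
  = binomial_conv n u (fun k => binomial_conv k v w).
Proof.
  revert u v w. induction n as [|n IH]; intros u v w; simpl; [ring|].
  rewrite binomial_conv_plus_l, binomial_conv_plus_r, !IH. ring.
Qed.

Lemma binomial_conv_one_l (n : nat) (v : nat -> C) :
  binomial_conv n (fun k => if k =? 0 then RtoC 1 else RtoC 0) v = v n.
Proof.
  revert v. induction n as [|n IH]; intros v; simpl; [ring|].
  rewrite (IH (fun k => v (S k))).
  (* The shifted unit is the zero sequence, written as a product so that the scalar [0] can be
     pulled out. *)
  rewrite (binomial_conv_ext n _ (fun _ => (RtoC 0 * RtoC 0)%C) v v);
    [|intros k; ring|reflexivity].
  rewrite (binomial_conv_scal_l n (RtoC 0) (fun _ => RtoC 0)). ring.
Qed.

(** * Binomial convolution as an explicit sum *)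

Lemma binomial_pred (n k : nat) :
  INR (S k) / INR (S n) * Binomial.C (S n) (S k) = Binomial.C n k.
Proof.
  unfold Binomial.C. cbn [Nat.sub]. rewrite !fact_simpl, !mult_INR.
  field. repeat split; try apply INR_fact_neq_0; now apply not_0_INR.
Qed.

Lemma binomial_row_pred (n k : nat) : (k <= n)%nat ->
  (1 - INR k / INR (S n)) * Binomial.C (S n) k = Binomial.C n k.
Proof.
  intros H. unfold Binomial.C. replace (S n - k)%nat with (S (n - k)) by lia.
  rewrite !fact_simpl, !mult_INR.
  assert (Hs : INR (S (n - k)) = INR (S n) - INR k).
  { rewrite <- minus_INR by lia. f_equal. lia. }
  assert (H0 : INR (S (n - k)) <> 0) by now apply not_0_INR.
  rewrite Hs in *. field.
  repeat split; try apply INR_fact_neq_0; auto. now apply not_0_INR.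
Qed.

Lemma binomial_conv_sum (n : nat) (u v : nat -> C) :
  binomial_conv n u v
  = sum_n (fun k => (RtoC (Binomial.C n k) * (u k * v (n - k)%nat))%C) n.
Proof.
  revert u v. induction n as [|n IH]; intros u v.
  - rewrite sum_O. simpl. unfold Binomial.C. simpl.
    replace (1 / (1 * 1)) with 1 by field. Cring.
  - (* Pascal's rule, by splitting each term in proportions
       [k / (n + 1)] and [1 - k / (n + 1)]. *)
    set (f := fun k => (RtoC (Binomial.C (S n) k) * (u k * v (S n - k)%nat))%C).
    set (al := fun k => (RtoC (INR k / INR (S n)) * f k)%C).
    set (be := fun k => (RtoC (1 - INR k / INR (S n)) * f k)%C).
    assert (Hf : sum_n f (S n) = (sum_n al (S n) + sum_n be (S n))%C).
    { rewrite <- (sum_n_plus al be). apply sum_n_ext. intros k.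
      change (f k = (al k + be k)%C). unfold al, be.
      rewrite RtoC_minus. Cring. }
    rewrite Hf. cbn [binomial_conv]. f_equal; rewrite IH.
    + unfold sum_n at 2. rewrite sum_Sn_m by lia. rewrite <- sum_n_m_S.
      assert (H0 : al 0%nat = zero).
      { unfold al. simpl INR. unfold Rdiv. rewrite Rmult_0_l. apply Cmult_0_l. }
      rewrite H0, plus_zero_l. apply sum_n_ext. intros k.
      unfold al, f. rewrite <- (binomial_pred n k), RtoC_mult.
      cbn [Nat.sub]. Cring.
    (* The top term goes because its proportion is zero at [k = S n]; the others satisfy [k <= n],
       as [binomial_row_pred] requires. *)
    + rewrite sum_Sn.
      assert (H0 : be (S n) = zero).
      { unfold be. unfold Rdiv. rewrite Rinv_r by now apply not_0_INR.
        rewrite Rminus_diag. apply Cmult_0_l. }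
      rewrite H0, plus_zero_r. apply sum_n_ext_loc. intros k Hk.
      unfold be, f. rewrite <- (binomial_row_pred n k Hk), RtoC_mult.
      replace (S n - k)%nat with (S (n - k)) by lia. Cring.
Qed.

Lemma sum_n_even_terms (g : nat -> C) (n : nat) :
  (forall k, g (S (2 * k)) = RtoC 0) ->
  sum_n g n = sum_n (fun k => g (2 * k)%nat) (Nat.div n 2).
Proof.
  intros Hg.
  assert (H : forall m, sum_n g (2 * m) = sum_n (fun k => g (2 * k)%nat) m
              /\ sum_n g (S (2 * m)) = sum_n (fun k => g (2 * k)%nat) m).
  { assert (Hs : forall m, sum_n g (S (2 * m)) = sum_n g (2 * m)).
    { intros m. rewrite sum_Sn, Hg. apply Cplus_0_r. }
    intros m. rewrite Hs. enough (E : sum_n g (2 * m)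
      = sum_n (fun k => g (2 * k)%nat) m) by now split.
    induction m as [|m IH].
    - now rewrite !sum_O.
    - replace (2 * S m)%nat with (S (S (2 * m))) by lia.
      rewrite (sum_Sn g), Hs, IH, (sum_Sn _ m).
      now replace (S (S (2 * m))) with (2 * S m)%nat by lia. }
  rewrite (Nat.div_mod_eq n 2) at 1.
  assert (Hr := Nat.mod_upper_bound n 2 ltac:(lia)).
  destruct (Nat.modulo n 2) as [|[|r]]; [| |lia].
  - rewrite Nat.add_0_r. apply H.
  - rewrite Nat.add_1_r. apply H.
Qed.

(** * Even-indexed Lucas-balancing polynomials *)

(* The exponential generating function of this sequence is
   [cosh (sqrt D * z)]. *)
Definition even_powers (D : C) (k : nat) : C :=
  if Nat.even k then (D ^ Nat.div2 k)%C else RtoC 0.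

(** This is the differential equation [y'' = 2 a y' - (a^2 - D) y] of
    [y = exp(a z) cosh(sqrt(D) z)], whose characteristic roots are [a + sqrt(D)] and
    [a - sqrt(D)]. *)
Lemma exp_cosh_conv_rec (a D : C) (n : nat) :
  let T m := binomial_conv m (fun k => (a ^ k)%C) (even_powers D) in
  T (S (S n)) = (RtoC 2 * a * T (S n) - (a * a - D) * T n)%C.
Proof.
  assert (L : forall m v, binomial_conv (S m) (fun k => (a ^ k)%C) v
    = (a * binomial_conv m (fun k => (a ^ k)%C) v
       + binomial_conv m (fun k => (a ^ k)%C) (fun k => v (S k)))%C).
  { intros m v. cbn [binomial_conv].
    now rewrite <- (binomial_conv_scal_l m a). }
  cbv beta zeta. rewrite !L.
  rewrite (binomial_conv_ext n _ (fun k => (a ^ k)%C)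
             (fun k => even_powers D (S (S k)))
             (fun k => (D * even_powers D k)%C)).
  - rewrite binomial_conv_scal_r. Cring.
  - reflexivity.
  - intros k. unfold even_powers. simpl. destruct (Nat.even k); Cring.
Qed.

(** Two steps of the defining recurrence give [C_{2m+4} = (36 x^2 - 2) C_{2m+2} - C_{2m}], which is
    the recurrence of [exp_cosh_conv_rec] since [2 a = 36 x^2 - 2] and [a^2 - D = 1]. *)
Lemma lucas_balancing_double_conv (n : nat) (x : C) :
  lucas_balancing (2 * n) x
  = binomial_conv n (fun k => ((RtoC 18 * x ^ 2 - RtoC 1) ^ k)%C)
      (even_powers (RtoC 36 * x ^ 2 * (RtoC 9 * x ^ 2 - RtoC 1))%C).
Proof.
  induction n as [n IH] using lt_wf_ind. destruct n as [|[|n]].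
  - unfold even_powers. simpl. Cring.
  - unfold even_powers. simpl. Cring.
  - rewrite exp_cosh_conv_rec.
    rewrite <- (IH (S n)), <- (IH n) by lia.
    assert (R : forall m, lucas_balancing (S (S m)) x
      = (RtoC 6 * x * lucas_balancing (S m) x - lucas_balancing m x)%C)
      by reflexivity.
    replace (2 * S (S n))%nat with (S (S (S (S (2 * n))))) by lia.
    replace (2 * S n)%nat with (S (S (2 * n))) by lia.
    rewrite !R. Cring.
Qed.

(** * Euler numbers as a convolution inverse *)

(** Near 0 the product of the series of [1 / cosh z] and [cosh z] is 1, and a power series is
    determined by its values near 0. *)
Lemma euler_cosh_cauchy (n : nat) :
  PS_mult (fun k => euler_number k / INR (fact k)) cosh_coef n
  = if n =? 0 then 1 else 0.
Proof.
  assert (HE := euler_numberP). unfold euler_egf in HE.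
  set (a := fun k => euler_number k / INR (fact k)) in *.
  assert (Hm : locally 0 (fun z : R => is_pseries (PS_mult a cosh_coef) z 1)).
  (* The Cauchy product needs [z] strictly inside the disk of convergence. Convergence at [d / 2]
     bounds the radius below, hence the smaller ball. *)
  { assert (Hin : locally 0 (fun z : R => Rbar_lt (Rabs z) (CV_radius a))).
    { destruct HE as [d Hd]. assert (d0 := cond_pos d).
      exists (mkposreal (d / 2) ltac:(lra)). intros z Hz.
      change (Rabs (z - 0) < d / 2) in Hz. rewrite Rminus_0_r in Hz.
      apply Rbar_lt_le_trans with (Rabs (d / 2)).
      - simpl. rewrite (Rabs_pos_eq (d / 2)); lra.
      - apply Rbar_not_lt_le. intros Hlt.
        apply (CV_disk_outside _ _ Hlt). apply ex_series_lim_0.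
        apply ex_series_ext with (fun k => scal (pow_n (d / 2) k) (a k)).
        + intros k. rewrite pow_n_pow. apply Rmult_comm.
        + eexists. apply Hd. change (Rabs (d / 2 - 0) < d).
          rewrite Rminus_0_r, Rabs_pos_eq; lra. }
    generalize (filter_and _ _ HE Hin). apply filter_imp. intros z [H1 H2].
    assert (H := is_pseries_mult _ _ _ _ _ H1 (is_pseries_cosh z) H2
                   (CV_radius_cosh z)).
    replace 1 with (1 / cosh z * cosh z); [exact H|].
    assert (0 < cosh z).
    { unfold cosh. assert (P1 := exp_pos z). assert (P2 := exp_pos (- z)). lra. }
    field. lra. }
  assert (H1 : forall z : R,
    is_pseries (fun k => if k =? 0 then 1 else 0) z 1).
  { intros z. apply filterlim_ext with (fun _ => 1); [|apply filterlim_const].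
    intros k. induction k as [|k IH].
    - rewrite sum_O. unfold scal; simpl; unfold mult; simpl.
      now rewrite Rmult_1_l.
    - rewrite sum_Sn, <- IH. cbn [Nat.eqb].
      rewrite (scal_zero_r (V := R_NormedModule)).
      now rewrite plus_zero_r. }
  apply (PSeries_ext_recip (PS_mult a cosh_coef)
           (fun k => if k =? 0 then 1 else 0)).
  - exact (CV_radius_pos_of_near0 _ _ Hm).
  - apply (CV_radius_pos_of_near0 _ (fun _ => 1)).
    apply filter_forall. exact H1.
  - generalize Hm. apply filter_imp. intros z Hz.
    transitivity 1; [|symmetry]; now apply is_pseries_unique.
Qed.

Lemma cosh_coef_even (k : nat) :
  cosh_coef k = (if Nat.even k then 1 else 0) / INR (fact k).
Proof.
  assert (H : (-1) ^ k = if Nat.even k then 1 else -1).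
  { induction k as [|k IH]; [reflexivity|].
    rewrite Nat.even_succ, <- Nat.negb_even. simpl. rewrite IH.
    destruct (Nat.even k); simpl; ring. }
  unfold cosh_coef. rewrite H. f_equal. destruct (Nat.even k); field.
Qed.

Lemma euler_binomial_sum (n : nat) :
  sum_n (fun k => Binomial.C n k
                  * (euler_number k * if Nat.even (n - k) then 1 else 0)) n
  = if n =? 0 then 1 else 0.
Proof.
  transitivity (INR (fact n) * if n =? 0 then 1 else 0);
    [|destruct n; simpl; ring].
  rewrite <- euler_cosh_cauchy. unfold PS_mult.
  rewrite sum_n_Reals, scal_sum. apply sum_eq. intros k _.
  rewrite cosh_coef_even. unfold Binomial.C.
  field. split; apply INR_fact_neq_0.
Qed.

Lemma RtoC_sum_n (f : nat -> R) (n : nat) :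
  RtoC (sum_n f n) = sum_n (fun k => RtoC (f k)) n.
Proof.
  induction n as [|n IH]; [now rewrite !sum_O|].
  rewrite !sum_Sn, <- IH. apply RtoC_plus.
Qed.

(** The parity factor handles [i] and [j] both odd, where [i + j] is even but the product is 0. *)
Lemma even_powers_mul (D : C) (i j : nat) :
  (even_powers D i * even_powers D j)%C
  = (even_powers D (i + j) * RtoC (if Nat.even j then 1 else 0))%C.
Proof.
  unfold even_powers. rewrite Nat.even_add.
  destruct (Nat.even i) eqn:Ei, (Nat.even j) eqn:Ej; simpl; try ring.
  apply Nat.even_spec in Ei as [p ->]. apply Nat.even_spec in Ej as [q ->].
  rewrite <- Nat.mul_add_distr_l, !Nat.div2_double, Cpow_add_r. ring.
Qed.

(** Substituting [sqrt(D) z] for [z] is done without a square root: [even_powers D n] factors out of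
    the sum, leaving the case [D = 1] of [euler_binomial_sum]. *)
Lemma euler_conv_even_powers (D : C) (n : nat) :
  binomial_conv n (fun k => (even_powers D k * RtoC (euler_number k))%C)
    (even_powers D)
  = if n =? 0 then RtoC 1 else RtoC 0.
Proof.
  rewrite binomial_conv_sum.
  transitivity (even_powers D n * RtoC (if n =? 0 then 1 else 0))%C.
  - rewrite <- euler_binomial_sum, RtoC_sum_n.
    rewrite <- (sum_n_mult_l (even_powers D n : C_Ring)).
    apply sum_n_ext_loc. intros k Hk.
    assert (H := even_powers_mul D k (n - k)).
    replace (k + (n - k))%nat with n in H by lia.
    rewrite !RtoC_mult. change mult with Cmult.
    transitivity (RtoC (Binomial.C n k) * RtoC (euler_number k)
                  * (even_powers D k * even_powers D (n - k)))%C; [Cring|].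
    rewrite H. Cring.
  - destruct n; unfold even_powers; simpl; Cring.
Qed.

Theorem theorem3 (n : nat) (x : C) :
  sum_n (fun k : nat =>
    (RtoC (Binomial.C n (2 * k)) * lucas_balancing (2 * (n - 2 * k)) x
     * (RtoC 36 * x ^ 2 * (RtoC 9 * x ^ 2 - RtoC 1)) ^ k
     * RtoC (euler_number (2 * k)))%C) (Nat.div n 2)
  = ((RtoC 18 * x ^ 2 - RtoC 1) ^ n)%C.
Proof.
  set (D := (RtoC 36 * x ^ 2 * (RtoC 9 * x ^ 2 - RtoC 1))%C).
  set (e := fun k => (even_powers D k * RtoC (euler_number k))%C).
  set (p := fun k => ((RtoC 18 * x ^ 2 - RtoC 1) ^ k)%C).
  transitivity (binomial_conv n e (fun k => lucas_balancing (2 * k) x)).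
  (* The odd terms of [e] vanish, so the convolution runs over the indices [2 * k] only. *)
  - rewrite binomial_conv_sum, (sum_n_even_terms _ n).
    + apply sum_n_ext. intros k. unfold e, even_powers.
      rewrite Nat.even_even, Nat.div2_double. Cring.
    + intros k. unfold e, even_powers.
      replace (S (2 * k)) with (2 * k + 1)%nat by lia.
      rewrite Nat.even_odd. Cring.
  - rewrite (binomial_conv_ext n e e _
               (fun k => binomial_conv k (even_powers D) p)).
    (* Regrouping puts [e] next to [even_powers D]; their convolution is the unit, which leaves
       [p n]. *)
    + rewrite <- binomial_conv_assoc.
      etransitivity; [|apply binomial_conv_one_l].
      apply binomial_conv_ext; [apply euler_conv_even_powers|reflexivity].
    + reflexivity.
    + intros k. rewrite lucas_balancing_double_conv. apply binomial_conv_comm.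
Qed.
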